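(* For every finite state space $E=\{1,\dots,N\}$ there exist a finite set $G$ and a bijection $\phi:E\times G\to E\times G$ such that for every transition rate matrix $R$ on $E$ there exist a probability $q$ on $G$ and a rate $\lambda>0$ with the following property: under the probabilities $\mathbb P_{k}=\delta_k\otimes q^{\otimes\mathbb Z}\otimes Q^\lambda_{\mathbb R}$, $k\in E$, the process $X_t=X_0\circ\alpha_t$ ($t\ge0$) on $\Omega=E\times\Gamma^G_{\mathbb R}$ is a Markov chain with respect to $(\mathcal F_t)_{t\ge0}$ with transition rate matrix $R$ and $X_0=k$ $\mathbb P_k$-a.s. In particular the same $(G,\phi)$, hence the same environment space and the same deterministic invertible global evolution $(\alpha_t)_{t\in\mathbb R}$, serve for all transition rate matrices $R$, only $q$ and $\lambda$ depending on $R$.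
   Context: A transition rate matrix on $E$ is a real matrix $R=(R_{ij})$ with $R_{ij}\ge0$ for $i\ne j$ and $\sum_jR_{ij}=0$ for all $i$. $\Gamma^G_{\mathbb R}$ is the set of sequences $\gamma=(g_n,t_n)_{n\in\mathbb Z}$ with $g_n\in G$, $t_n\in[-\infty,+\infty]$, $\dots\le t_0\le0<t_1\le t_2\le\dots$, $t_n<t_{n+1}$ whenever $|t_n|<\infty$, finitely many finite $t_n$ in bounded intervals. Coordinates on $\Omega=E\times\Gamma^G_{\mathbb R}$: $X_0(i,\gamma)=i$, $Y_n=g_n$, $T_n=t_n$; $\mathcal F=\sigma(X_0,Y_n,T_n;n\in\mathbb Z)$; $N_g(t)=\sum_{n\ge1}\mathbf 1_{\{Y_n=g,0<T_n\le t\}}$, $N(t)=\sum_gN_g(t)$, $\mathcal F_t=\sigma(X_0,N_g(s);g\in G,0\le s\le t)$. $\mathbb P_k$: $X_0=k$ a.s., marks $(Y_n)_{n\in\mathbb Z}$ i.i.d. with law $q$, independent of $(T_n)$, which are the points of a rate-$\lambda$ homogeneous Poisson process on $\mathbb R$ ($T_1$ the first positive point). The shift $\vartheta_t$ maps $(i,(g_n,t_n))$ to $(i,(g_n,t_n-t))$ re-indexed so index $1$ is the first positive time. With $\varphi_m=\phi_{(m)}\circ\dots\circ\phi_{(1)}$ on $E\times G^m$ ($\phi_{(n)}$ applying $\phi$ to the first coordinate and the $n$-th $G$-coordinate), $\psi_t(i,(g_n,t_n))=(i',(g'_n,t_n))$ for $t\ge0$, where with $m=N(t)$: $(i',g'_1,\dots,g'_m)=\varphi_m(i,g_1,\dots,g_m)$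 and $g'_n=g_n$ otherwise. $\alpha_t=\vartheta_t\circ\psi_t$ for $t\ge0$ and $\alpha_t=\psi_{|t|}^{-1}\circ\vartheta_t$ for $t\le0$; $X_0\circ\alpha_t$ is the $E$-coordinate of $\alpha_t$. *)

(* Defs.v *)
From HB Require Import structures.
From mathcomp Require Import all_boot all_order all_algebra.
From mathcomp Require Import all_classical all_reals all_analysis measurable_realfun.
Set Implicit Arguments. Unset Strict Implicit. Unset Printing Implicit Defensive.
Import Order.TTheory GRing.Theory Num.Theory.
Local Open Scope classical_set_scope.
Local Open Scope ring_scope.

HB.instance Definition _ (n : nat) := isPointed.Build 'I_n.+1 ord0.

Definition rate_matrix (R : realType) (n : nat) (Q : 'M[R]_n) : Prop :=
  (forall i j, i != j -> 0 <= Q i j) /\ (forall i, \sum_j Q i j = 0).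

Definition expmx (R : realType) (n : nat) (t : R) (Q : 'M[R]_n.+1) i j : R :=
  limn (fun K => \sum_(k < K) (t ^+ k / (k`!)%:R) * (Q ^+ k) i j).

Definition poisson_weight (R : realType) (mu : R) (k : nat) : R :=
  expR (- mu) * mu ^+ k / (k`!)%:R.

Definition prob_vector (R : realType) (G : finType) (q : G -> R) : Prop :=
  (forall g, 0 <= q g) /\ \sum_g q g = 1.

Definition hasCount (P : int -> Prop) (m : nat) : Prop :=
  exists s : seq int, [/\ uniq s, size s = m & forall n, n \in s <-> P n].

Definition Raw (N M : nat) (R : realType) :=
  ('I_N.+1 * (int -> 'I_M.+1) * (int -> \bar R))%type.

Section coords.
Context {N M : nat} {R : realType}.
Definition X0 (w : Raw N M R) : 'I_N.+1 := w.1.1.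
Definition Y (w : Raw N M R) : int -> 'I_M.+1 := w.1.2.
Definition T (w : Raw N M R) : int -> \bar R := w.2.

Definition inGamma (w : Raw N M R) : Prop :=
  [/\ (forall n, (T w n <= T w (n + 1))%E),
      (T w 0 <= 0)%E, (0 < T w 1)%E,
      (forall n, T w n \is a fin_num -> (T w n < T w (n + 1))%E) &
      (forall a b : R, exists s : seq int, forall n,
          T w n \is a fin_num -> (a%:E <= T w n <= b%:E)%E -> n \in s)].
Definition Gamma : set (Raw N M R) := [set w | inGamma w].

Definition coordGen : set (set (Raw N M R)) :=
  [set A | (exists i, A = [set w | X0 w = i])
        \/ (exists n g, A = [set w | Y w n = g])
        \/ (exists n (B : set (\bar R)), measurable B /\ A = [set w | B (T w n)])].

(* N(t) = #{n >= 1 : 0 < T_n <= t}  (finite on Gamma) *)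
Definition Ncnt (t : R) (w : Raw N M R) : nat :=
  xget 0%N [set m | hasCount (fun n => 0 < n /\ (0 < T w n <= t%:E)%E) m].

Definition phi_at (phi : 'I_N.+1 * 'I_M.+1 -> 'I_N.+1 * 'I_M.+1) (n : int)
    (x : 'I_N.+1 * (int -> 'I_M.+1)) : 'I_N.+1 * (int -> 'I_M.+1) :=
  let z := phi (x.1, x.2 n) in (z.1, fun k => if k == n then z.2 else x.2 k).
Fixpoint phi_iter phi (m : nat) (x : 'I_N.+1 * (int -> 'I_M.+1)) :=
  match m with
  | 0%N => x
  | m'.+1 => phi_at phi (Posz m'.+1) (phi_iter phi m' x)
  end.

Definition psi phi (t : R) (w : Raw N M R) : Raw N M R :=
  let x := phi_iter phi (Ncnt t w) (X0 w, Y w) in (x.1, x.2, T w).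
(* theta_t for t >= 0: times shifted by -t, reindexed so that index 1 is the
   first positive time (on Gamma, the first positive time of the shifted
   sequence has old index N(t)+1) *)
Definition vartheta (t : R) (w : Raw N M R) : Raw N M R :=
  let c := Posz (Ncnt t w) in
  (X0 w, fun n => Y w (n + c), fun n => (T w (n + c) - t%:E)%E).
Definition alpha phi (t : R) (w : Raw N M R) : Raw N M R := vartheta t (psi phi t w).
Definition Xt phi (t : R) (w : Raw N M R) : 'I_N.+1 := X0 (alpha phi t w).

Definition filtGen (t : R) : set (set (Raw N M R)) :=
  [set A | (exists i, A = [set w | X0 w = i])
        \/ (exists g s m, 0 <= s <= t /\
              A = [set w | hasCount (fun n => [/\ 0 < n, Y w n = g
                                              & (0 < T w n <= s%:E)%E]) m])].
Definition Filt (t : R) : set (set (Raw N M R)) := <<s filtGen t >>.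
End coords.

Definition Omega (N M : nat) (R : realType) :=
  g_sigma_algebraType (@coordGen N M R).

(* P = delta_k (x) q^{(x)Z} (x) Q^lambda_R, characterised by its
   finite-dimensional distributions and by being carried by E x Gamma *)
Definition law_Pk (N M : nat) (R : realType) (k : 'I_N.+1) (q : 'I_M.+1 -> R)
    (lam : R) (P : probability (Omega N M R) R) : Prop :=
  P (@Gamma N M R) = 1%E /\
  forall (S : seq int) (g : int -> 'I_M.+1) (m : nat) (s : nat -> R) (c : nat -> nat),
    uniq S -> (forall j, (j < m)%N -> s j <= s j.+1) ->
    P [set w : Omega N M R | [/\ X0 w = k,
           (forall n, n \in S -> Y w n = g n) &
           (forall j, (j < m)%N ->
              hasCount (fun n => ((s j)%:E < T w n <= (s j.+1)%:E)%E) (c j))]]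
    = ((\prod_(n <- S) q (g n)) *
       \prod_(j < m) poisson_weight (lam * (s j.+1 - s j)) (c j))%:E.

(* (X_t)_{t>=0} is a Markov chain w.r.t. (F_t) with rate matrix Q and X_0 = k a.s.
   (on Omega = E x Gamma: events are traced on Gamma) *)
Definition markov_chain_rate (N M : nat) (R : realType)
    (phi : 'I_N.+1 * 'I_M.+1 -> 'I_N.+1 * 'I_M.+1) (Q : 'M[R]_N.+1)
    (k : 'I_N.+1) (P : probability (Omega N M R) R) : Prop :=
  [/\
      (forall (t : R) i, 0 <= t -> exists A, Filt t A /\
          A `&` Gamma = [set w | Xt phi t w = i] `&` (@Gamma N M R)),
      (forall (s t : R) (A : set (Omega N M R)) i j, 0 <= s -> 0 <= t -> Filt s A ->
          P (A `&` Gamma `&` [set w | Xt phi s w = i /\ Xt phi (s + t) w = j])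
          = (P (A `&` Gamma `&` [set w | Xt phi s w = i]) * (expmx t Q i j)%:E)%E) &
      P [set w | Xt phi 0 w = k] = 1%E].

(* Main.v *)
(** Every stochastic matrix [Pm] on [E] is realised by a random map [f : E -> E]
    whose values [f i] are independent with law [Pm i].  The evaluation
    [(i, f) |-> f i] is balanced ([f i] takes each value for exactly [#|G|] pairs),
    so it is the first coordinate of a bijection of [E * G], [G] the set of all
    maps; this bijection does not depend on [Pm].  A rate matrix [Q] is
    uniformised as [Q = lam (Pm - 1)], so that [expmx t Q] is the Poisson mixture
    of the powers of [Pm], and [X_t] is the chain driven by the marks, run for
    [N(t)] steps.  For the Markov property, sets depending only on the initial
    state, the past marks and [N] at finitely many past times form a pi-system
    containing the generators of [Filt s]; on each of their countably many cells
    the law gives the independence of the next marks and jump count, and a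
    Dynkin argument concludes. *)

Require Import Defs.
From HB Require Import structures.
From mathcomp Require Import all_boot all_order all_algebra.
From mathcomp Require Import all_classical all_reals all_analysis measurable_realfun.
From mathcomp Require Import perm.
From mathcomp Require Import ring lra zify.
Import Order.TTheory GRing.Theory Num.Theory.
Import numFieldNormedType.Exports.
Set Implicit Arguments. Unset Strict Implicit. Unset Printing Implicit Defensive.
Local Open Scope classical_set_scope.
Local Open Scope ring_scope.

(** * Random maps and uniformization *)

Definition stochastic (R : realType) (n : nat) (P : 'M[R]_n) : Prop :=
  (forall i j, 0 <= P i j) /\ (forall i, \sum_j P i j = 1).

Section RandomMap.
Context (E : finType) (e0 : E).

(* [f] is first transposed so that its value at [i] sits at the base point
   [e0]; that value is then exchanged with [i]. *)
Definition map_exchange (z : E * {ffun E -> E}) : E * {ffun E -> E} :=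
  (z.2 z.1,
   [ffun x => if x == e0 then z.1 else z.2 (tperm e0 z.1 x)]).

(** The value at [e0] stores the old state, which tells which transposition to undo. *)
Definition map_exchange_inv (z : E * {ffun E -> E}) : E * {ffun E -> E} :=
  (z.2 e0,
   [ffun x => let y := tperm e0 (z.2 e0) x in if y == e0 then z.1 else z.2 y]).

Lemma map_exchange_bij : bijective map_exchange.
Proof.
exists map_exchange_inv => -[i f]; rewrite /map_exchange /map_exchange_inv /=.
  rewrite ffunE eqxx; congr pair; apply/ffunP => x; rewrite !ffunE.
  case: (eqVneq (tperm e0 i x) e0) => [ex|_]; last by rewrite tpermK.
  by rewrite -[x in RHS](tpermK e0 i) ex tpermL.
congr pair; first by rewrite ffunE tpermR eqxx.
by apply/ffunP => x; rewrite !ffunE tpermK; case: (eqVneq x e0) => [->|].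
Qed.

(** Killing the weights of the [i]-th factor off [j] removes the constraint; the sum then factors
    over the points, and each factor other than the [i]-th sums to 1. This is the marginal law of
    one value of a random map with independent values. *)
Lemma sum_product_law (R : realType) (P : E -> E -> R) (i j : E) :
  (forall x, \sum_y P x y = 1) ->
  \sum_(f : {ffun E -> E} | f i == j) \prod_x P x (f x) = P i j.
Proof.
move=> P1.
pose P' x y := if x == i then (if y == j then P x y else 0) else P x y.
transitivity (\sum_(f : {ffun E -> E}) \prod_x P' x (f x)).
  rewrite [LHS]big_mkcond; apply: eq_bigr => f _; case: eqP => fi.
    by apply: eq_bigr => x _; rewrite /P'; case: eqP => // ->; rewrite fi eqxx.
  by rewrite (bigD1 i) //= /P' eqxx; case: eqP => // _; rewrite mul0r.
rewrite -bigA_distr_bigA (bigD1 i) //= [X in _ * X]big1 ?mulr1.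
  rewrite (bigD1 j) //= big1 ?addr0 /P' ?eqxx //.
  by move=> y /negPf ->.
by move=> x /negPf xi; rewrite -(P1 x); apply: eq_bigr => y _; rewrite /P' xi.
Qed.

End RandomMap.

(** A mark is the number of a map, [phi] is [map_exchange] read through this numbering, and [q] is
    the product of the rows of [P]. Only [q] involves [P]. *)
Lemma universal_random_map (N : nat) :
  exists (M : nat) (phi : 'I_N.+1 * 'I_M.+1 -> 'I_N.+1 * 'I_M.+1),
    bijective phi /\
    forall (R : realType) (P : 'M[R]_N.+1), stochastic P ->
      exists q : 'I_M.+1 -> R, prob_vector q /\
        forall i j, \sum_(g | (phi (i, g)).1 == j) q g = P i j.
Proof.
pose G := {ffun 'I_N.+1 -> 'I_N.+1}.
have cardG : #|G| = #|G|.-1.+1.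
  by rewrite prednK //; apply/card_gt0P; exists [ffun=> ord0].
pose code (f : G) := cast_ord cardG (enum_rank f).
pose decode (g : 'I_(#|G|.-1.+1)) : G := enum_val (cast_ord (esym cardG) g).
have codeK : cancel code decode.
  by move=> f; rewrite /decode /code cast_ordK enum_rankK.
have decodeK : cancel decode code.
  by move=> f; rewrite /decode /code enum_valK cast_ordKV.
have decode_bij : bijective decode by exists code.
pose pd (z : 'I_N.+1 * 'I_(#|G|.-1.+1)) := (z.1, decode z.2).
pose pc (z : 'I_N.+1 * G) := (z.1, code z.2).
exists #|G|.-1, (pc \o map_exchange ord0 \o pd); split.
  apply: bij_comp; last by exists pc => -[i g]; rewrite /pd /pc /= ?codeK ?decodeK.
  apply: bij_comp; last exact: map_exchange_bij.
  by exists pd => -[i g]; rewrite /pd /pc /= ?codeK ?decodeK.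
move=> R P [P0 P1]; exists (fun g => \prod_x P x (decode g x)); split.
  split=> [g|]; first by apply: prodr_ge0.
  rewrite -(reindex decode (P := predT)
              (F := fun f : G => \prod_x P x (f x))) /=.
    by rewrite -bigA_distr_bigA big1.
  exact: onW_bij.
move=> i j; rewrite -(sum_product_law i j P1) [RHS](reindex decode) //=.
exact: onW_bij.
Qed.

(** * Uniformization: the matrix exponential as a Poisson mixture of powers *)

Section Uniformization.
Context (R : realType) (N : nat).
Implicit Types (P Q : 'M[R]_N.+1).

Lemma stochastic_expr P n : stochastic P -> stochastic (P ^+ n).
Proof.
move=> [P0 P1]; elim: n => [|n [Pn0 Pn1]].
  split=> [i j|i]; rewrite expr0; first by rewrite mxE ler0n.
  rewrite (bigD1 i) //= mxE eqxx big1 ?addr0 // => j ji.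
  by rewrite mxE eq_sym (negPf ji).
split=> [i j|i]; rewrite exprS.
  by rewrite mxE; apply: sumr_ge0 => k _; rewrite mulr_ge0.
under eq_bigr do rewrite mxE.
rewrite exchange_big -[RHS](P1 i); apply: eq_bigr => k _.
by rewrite -mulr_sumr Pn1 mulr1.
Qed.

Lemma stochastic_le1 P i j : stochastic P -> P i j <= 1.
Proof. by case=> P0 P1; rewrite -(P1 i) (bigD1 j) //= lerDl sumr_ge0. Qed.

(** Both sides run over the triangle i + j < K, by antidiagonals on the left and by columns on the
    right. *)
Lemma sum_antidiagonals (F : nat -> nat -> R) K :
  \sum_(k < K) \sum_(i < k.+1) F (k - i)%N i =
  \sum_(i < K) \sum_(j < K | (i + j < K)%N) F j i.
Proof.
transitivity (\sum_(k < K) \sum_(i < K) \sum_(j < K | (i + j == k)%N) F j i).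
  apply: eq_bigr => k _.
  rewrite (big_ord_widen K (fun i => F (k - i)%N i)) ?ltn_ord // big_mkcond.
  apply: eq_bigr => i _; case: ifP => ik.
    have kiK : (k - i < K)%N by apply: leq_ltn_trans (leq_subr _ _) _.
    rewrite (big_pred1 (Ordinal kiK)) // => j /=.
    by rewrite -val_eqE /=; apply/eqP/eqP; lia.
  by rewrite big1 // => j /eqP; lia.
rewrite exchange_big; apply: eq_bigr => i _ /=.
rewrite [RHS]big_mkcond /=.
under eq_bigr do rewrite big_mkcond /=.
rewrite exchange_big; apply: eq_bigr => j _ /=; case: ltnP => ijK.
  rewrite (bigD1 (Ordinal ijK)) //= eqxx big1 ?addr0 // => k.
  by rewrite -val_eqE /= eq_sym => /negPf ->.
rewrite big1 // => k _; case: eqP => // ijk.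
by have := ltn_ord k; rewrite -ijk ltnNge ijK.
Qed.

(** The difference collects the products with i + j >= K, which are dominated termwise by those of
    the series x^n / n!. For that series the triangle sums to a partial sum of exp (x + x), by the
    binomial theorem. *)
Lemma cauchy_product_approx (a b : nat -> R) (x : R) K :
  (forall n, `|a n| <= x ^+ n / n`!%:R) -> (forall n, `|b n| <= x ^+ n / n`!%:R) ->
  `|(\sum_(k < K) \sum_(i < k.+1) a (k - i)%N * b i)
    - (\sum_(i < K) a i) * (\sum_(i < K) b i)|
  <= (\sum_(i < K) x ^+ i / i`!%:R) ^+ 2 - \sum_(i < K) (x + x) ^+ i / i`!%:R.
Proof.
pose e n : R := x ^+ n / n`!%:R => ae be.
have -> : \sum_(i < K) (x + x) ^+ i / i`!%:R =
          \sum_(k < K) \sum_(i < k.+1) e (k - i)%N * e i.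
  apply: eq_bigr => k _; rewrite exprDn mulr_suml; apply: eq_bigr => i _.
  have ik : (i <= k)%N by rewrite -ltnS.
  have /(congr1 (fun n : nat => n%:R : R)) := bin_fact ik; rewrite !natrM => Ek.
  have fN n : (n`!%:R : R) != 0 by rewrite pnatr_eq0 -lt0n fact_gt0.
  rewrite /e -Ek -mulr_natr; field; rewrite !fN /=.
  by rewrite pnatr_eq0 -lt0n bin_gt0 ik.
have prodE (u v : nat -> R) : (\sum_(i < K) u i) * (\sum_(i < K) v i) =
    \sum_(i < K) \sum_(j < K) u j * v i.
  rewrite exchange_big big_distrl /=; apply: eq_bigr => i _.
  by rewrite big_distrr.
rewrite (sum_antidiagonals (fun i j => a i * b j)).
rewrite (sum_antidiagonals (fun i j => e i * e j)).
rewrite expr2 (prodE a b) (prodE e e) -!sumrB (le_trans (ler_norm_sum _ _ _)) //.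
apply: ler_sum => i _.
rewrite [X in `|X - _|]big_mkcond [X in _ <= _ - X]big_mkcond /= -!sumrB.
apply: le_trans (ler_norm_sum _ _ _) _; apply: ler_sum => j _.
case: ifP => _; first by rewrite !subrr normr0.
by rewrite sub0r subr0 normrN normrM ler_pM.
Qed.

(** With x = lam t, this is the factorization exp (x (P - 1)) = exp (-x) exp (x P), obtained
    entrywise by a Cauchy product. It also shows that the [limn] in [expmx] is a genuine limit
    here. *)
Lemma poisson_series_cvg P (t lam : R) i j : stochastic P -> 0 <= t -> 0 <= lam ->
  (fun K => \sum_(n < K) poisson_weight (lam * t) n * (P ^+ n) i j) @ \oo
    --> expmx t (lam *: (P - 1)) i j.
Proof.
move=> stP t0 lam0; pose x := lam * t.
have x0 : 0 <= x by rewrite mulr_ge0.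
pose a n : R := (- x) ^+ n / n`!%:R.
pose b n : R := x ^+ n / n`!%:R * (P ^+ n) i j.
pose e n : R := x ^+ n / n`!%:R.
have e0 n : 0 <= e n by rewrite divr_ge0 ?exprn_ge0.
have b0 n : 0 <= b n by apply: mulr_ge0; [exact: e0|exact: (stochastic_expr n stP).1].
have be n : b n <= e n.
  by rewrite ler_piMr ?e0 // stochastic_le1 //; exact: stochastic_expr.
have expE (y : R) : (fun K => \sum_(n < K) y ^+ n / n`!%:R) @ \oo --> expR y.
  have := is_cvg_series_exp_coeff y; rewrite /expR /series /=.
  by under eq_fun do rewrite big_mkord.
pose A K := \sum_(n < K) a n; pose B K := \sum_(n < K) b n.
pose C K := \sum_(k < K) t ^+ k / k`!%:R * ((lam *: (P - 1)) ^+ k) i j.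
(* Binomial expansion of (P - 1)^k, valid because -1 and P commute. *)
have CE K : C K = \sum_(k < K) \sum_(i < k.+1) a (k - i)%N * b i.
  apply: eq_bigr => k _; rewrite addrC exprZn mxE mulrCA mulrA mulrA.
  have cP : GRing.comm (-1 : 'M[R]_N.+1) P by apply: commr_sym; exact: commrN1.
  rewrite -exprMn exprDn_comm // summxE mulr_sumr; apply: eq_bigr => l _.
  have lk : (l <= k)%N by rewrite -ltnS.
  have -> : ((-1) ^+ (k - l) * P ^+ l *+ 'C(k, l)) i j =
            (-1) ^+ (k - l) * (P ^+ l) i j * 'C(k, l)%:R.
    rewrite mulmxnE mulr_natr; congr (_ *+ _).
    by rewrite -signr_odd -[in RHS]signr_odd; case: (odd _);
       rewrite ?expr1 ?expr0 ?mulN1r ?mul1r ?mxE.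
  have /(congr1 (fun n : nat => n%:R : R)) := bin_fact lk; rewrite !natrM => Ek.
  have fN n : (n`!%:R : R) != 0 by rewrite pnatr_eq0 -lt0n fact_gt0.
  rewrite /a /b -Ek [(- x) ^+ _]exprNn -/x.
  rewrite -[in x ^+ k](subnK lk) exprD; field; rewrite !fN /=.
  by rewrite pnatr_eq0 -lt0n bin_gt0 lk.
have Bcvg : cvgn B.
  apply: nondecreasing_is_cvgn.
    apply/nondecreasing_seqP => n; rewrite /B big_ord_recr /= lerDl //.
  exists (expR x) => _ [n _ <-].
  apply: le_trans (_ : \sum_(k < n) e k <= _); first exact: ler_sum.
  rewrite -(cvg_lim (@Rhausdorff R) (expE x)).
  apply: nondecreasing_cvgn_le; last by apply/cvg_ex; exists (expR x).
  by apply/nondecreasing_seqP => m; rewrite big_ord_recr /= lerDl; exact: e0.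
have ABcvg : (fun K => A K * B K) @ \oo --> expR (- x) * limn B.
  by apply: cvgM Bcvg; exact: expE.
(* The bound [D] tends to exp x * exp x - exp (x + x) = 0. *)
have err0 : (fun K => C K - A K * B K) @ \oo --> (0 : R).
  pose D K := (\sum_(n < K) e n) ^+ 2 - \sum_(n < K) (x + x) ^+ n / n`!%:R.
  have D0 : D @ \oo --> (0 : R).
    rewrite (_ : 0 = expR x * expR x - expR (x + x)); last by rewrite expRD subrr.
    apply: cvgB; last exact: expE.
    by under eq_fun do rewrite expr2; apply: cvgM; exact: expE.
  apply/norm_cvg0P; apply: squeeze_cvgr (cvg_cst 0) D0.
  near=> K; rewrite normr_ge0 CE /=; apply: cauchy_product_approx => n.
    by rewrite /a normrM normrX normrN !ger0_norm // invr_ge0.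
  by rewrite ger0_norm.
have Ccvg : C @ \oo --> expR (- x) * limn B.
  have -> : C = (fun K => (C K - A K * B K) + A K * B K).
    by apply/funext => K; rewrite subrK.
  by rewrite -[X in _ --> X]add0r; apply: cvgD.
rewrite /expmx -/C (cvg_lim (@Rhausdorff R) Ccvg).
rewrite (_ : (fun K => _) = (fun K => expR (- x) * B K)).
  by apply: cvgM => //; exact: cvg_cst.
by apply/funext => K; rewrite /B mulr_sumr; apply: eq_bigr => n _;
   rewrite /poisson_weight /b -/x !mulrA.
Unshelve. all: by end_near. Qed.

Lemma rate_matrix_uniformization Q : rate_matrix Q ->
  exists P (lam : R), [/\ stochastic P, 0 < lam & Q = lam *: (P - 1)].
Proof.
(* [lam] dominates every diagonal entry, so 1 + Q / lam has a nonnegative diagonal; the summand 1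
   keeps [lam] positive even when Q = 0. *)
move=> [Q0 Q1]; pose lam : R := 1 + \sum_i `|Q i i|.
have lam0 : 0 < lam by rewrite ltr_pwDl // sumr_ge0.
exists (1 + lam^-1 *: Q), lam; split=> //; last first.
  by rewrite [1 + _]addrC addrK scalerA divff ?scale1r // gt_eqF.
split=> [i j|i].
  rewrite !mxE; have [->|ij] := eqVneq i j; last first.
    by rewrite add0r; apply: mulr_ge0; [rewrite invr_ge0 ltW|exact: Q0].
  have : `|lam^-1 * Q j j| <= 1.
    rewrite normrM gtr0_norm ?invr_gt0 // mulrC ler_pdivrMr // mul1r /lam.
    by rewrite (bigD1 j) //= addrCA lerDl addr_ge0 // sumr_ge0.
  by rewrite ler_norml => /andP[? _]; rewrite /=; lra.
under eq_bigr do rewrite mxE [X in _ + X]mxE.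
rewrite big_split /= -mulr_sumr Q1 mulr0 addr0 (bigD1 i) //= mxE eqxx.
by rewrite big1 ?addr0 // => j ji; rewrite mxE eq_sym (negPf ji).
Qed.

End Uniformization.

(** * Events and counting on the path space *)

Section Events.
Context d (T : measurableType d).
Implicit Types p q : T -> Prop.

Lemma measurable_event_not p :
  measurable [set w | p w] -> measurable [set w | ~ p w].
Proof. by move=> mp; rewrite -[X in measurable X]/(~` [set w | p w]); exact: measurableC. Qed.

Lemma measurable_event_and p q :
  measurable [set w | p w] -> measurable [set w | q w] ->
  measurable [set w | p w /\ q w].
Proof. exact: measurableI. Qed.

Lemma measurable_event_or p q :
  measurable [set w | p w] -> measurable [set w | q w] ->
  measurable [set w | p w \/ q w].
Proof. exact: measurableU. Qed.

Lemma measurable_event_imply p q :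
  measurable [set w | p w] -> measurable [set w | q w] ->
  measurable [set w | p w -> q w].
Proof.
move=> mp mq.
rewrite (_ : [set w | _] = [set w | ~ p w \/ q w]).
  by apply: measurable_event_or => //; exact: measurable_event_not.
apply/seteqP; split=> w /= h; last by case: h.
by case: (pselect (p w)) => pw; [right; exact: h|left].
Qed.

Lemma measurable_event_const (P : Prop) : measurable [set _ : T | P].
Proof.
case: (pselect P) => hP.
  by rewrite (_ : [set _ | _] = setT) //; apply/seteqP; split.
by rewrite (_ : [set _ | _] = set0) //; apply/seteqP; split.
Qed.

Lemma measurable_event_exists (C : countType) (p : C -> T -> Prop) :
  (forall c, measurable [set w | p c w]) -> measurable [set w | exists c, p c w].
Proof.
move=> mp; rewrite (_ : [set w | _] = \bigcup_c [set w | p c w]).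
  by apply: countable_bigcupT_measurable => //; exact: countableP.
by apply/seteqP; split=> w [c] => [|_] pc; exists c.
Qed.

Lemma measurable_event_forall (C : countType) (p : C -> T -> Prop) :
  (forall c, measurable [set w | p c w]) -> measurable [set w | forall c, p c w].
Proof.
move=> mp; rewrite (_ : [set w | _] = [set w | ~ exists c, ~ p c w]).
  apply/measurable_event_not/measurable_event_exists => c.
  exact: measurable_event_not.
apply/seteqP; split=> w /= h; first by move=> [c]; exact.
by move=> c; apply: contra_notP h => npc; exists c.
Qed.

(** The enumerating sequences form a countable type, so the existential is a countable union. *)
Lemma measurable_event_hasCount (p : int -> T -> Prop) m :
  (forall n, measurable [set w | p n w]) ->
  measurable [set w | hasCount (p^~ w) m].
Proof.
move=> mp; apply: measurable_event_exists => s.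
rewrite (_ : [set w | _] =
  [set w | (uniq s /\ size s = m) /\ forall n, n \in s <-> p n w]); last first.
  by apply/seteqP; split=> w /=; [case|move=> [[]]].
apply: measurable_event_and; first exact: measurable_event_const.
apply: measurable_event_forall => n.
by apply: measurable_event_and; apply: measurable_event_imply => //;
  exact: measurable_event_const.
Qed.

(* Measurability of a map into a countable type carrying its full power set. *)
Definition fiber_measurable (C : Type) (f : T -> C) :=
  forall c, measurable [set w | f w = c].

Lemma fiber_measurable_event (C : countType) (f : T -> C) (P : C -> T -> Prop) :
  fiber_measurable f -> (forall c, measurable [set w | P c w]) ->
  measurable [set w | P (f w) w].
Proof.
move=> mf mP.
rewrite (_ : [set w | _] = [set w | exists c, f w = c /\ P c w]); last first.
  by apply/seteqP; split=> w /= => [Pw|[c [-> //]]]; exists (f w).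
by apply: measurable_event_exists => c; exact: measurable_event_and.
Qed.

Lemma fiber_measurable_dep (C : countType) D (f : T -> C) (h : C -> T -> D) :
  fiber_measurable f -> (forall c, fiber_measurable (h c)) ->
  fiber_measurable (fun w => h (f w) w).
Proof.
by move=> mf mh d0; apply: (fiber_measurable_event (P := fun c w => h c w = d0)) => // c;
   exact: mh.
Qed.

Lemma fiber_measurable_comp (C : countType) D (f : T -> C) (h : C -> D) :
  fiber_measurable f -> fiber_measurable (fun w => h (f w)).
Proof.
move=> mf; apply: (fiber_measurable_dep (h := fun c _ => h c)) => // c d0.
exact: measurable_event_const.
Qed.

Lemma fiber_measurable_pair (C D : Type) (f : T -> C) (g : T -> D) :
  fiber_measurable f -> fiber_measurable g -> fiber_measurable (fun w => (f w, g w)).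
Proof.
move=> mf mg [c d0]; rewrite (_ : [set w | _] = [set w | f w = c /\ g w = d0]).
  exact: measurable_event_and.
by apply/seteqP; split=> w /=; [case=> -> ->|case=> -> ->].
Qed.

Lemma fiber_measurable_map (C : Type) (I : Type) (f : I -> T -> C) (s : seq I) :
  (forall i, fiber_measurable (f i)) -> fiber_measurable (fun w => [seq f i w | i <- s]).
Proof.
move=> mf; elim: s => [|i s IH] c /=; first exact: measurable_event_const.
case: c => [|x c].
  by rewrite (_ : [set w | _] = set0) //; apply/seteqP; split.
rewrite (_ : [set w | _] = [set w | f i w = x /\ [seq f j w | j <- s] = c]).
  by apply: measurable_event_and; [exact: mf|exact: IH].
by apply/seteqP; split=> w /=; [case=> -> ->|case=> -> ->].
Qed.

End Events.

(** * Jump times and the counting processes *)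

Section HasCount.
Implicit Types P : int -> Prop.

Lemma hasCount_inj P m m' : hasCount P m -> hasCount P m' -> m = m'.
Proof.
move=> [s [us <- sP]] [s' [us' <- s'P]]; apply/perm_size/uniq_perm => // n.
by apply/idP/idP => [/sP/s'P|/s'P/sP].
Qed.

Lemma hasCount_interval P a b :
  (forall n, P n <-> exists k, n = Posz k /\ (a < k <= b)%N) -> hasCount P (b - a).
Proof.
move=> hP; exists [seq Posz k | k <- iota a.+1 (b - a)]; split.
- by rewrite map_inj_uniq ?iota_uniq // => x y [].
- by rewrite size_map size_iota.
- move=> n; split=> [/mapP[k]|/hP[k [-> /andP[ak kb]]]].
    rewrite mem_iota => /andP[ak kab] ->; apply/hP; exists k; split=> //.
    by apply/andP; split=> //; lia.
  by apply/mapP; exists k => //; rewrite mem_iota; lia.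
Qed.

End HasCount.

Section Counting.
Context {N M : nat} {R : realType}.
Implicit Types (w : Raw N M R) (t u a b : R).

Lemma Gamma_homo w : Gamma w -> forall m n : int, (m <= n)%R -> (T w m <= T w n)%E.
Proof.
case=> mono _ _ _ _ m n mn.
have -> : n = m + (absz (n - m)) by lia.
elim: (absz _) => [|k IH]; first by rewrite addr0.
by apply: le_trans IH _; rewrite (_ : (m + k.+1)%R = (m + k)%R + 1) //; lia.
Qed.

Lemma Gamma_gt0 w n : Gamma w -> (0 < T w n)%E = (0 < n)%R.
Proof.
move=> Gw; have [_ T0 T1 _ _] := Gw; case: (ltP 0 n) => [n0|n0].
  by apply: lt_le_trans T1 (Gamma_homo Gw _); lia.
by apply/negbTE; rewrite -leNgt; apply: le_trans (Gamma_homo Gw n0) T0.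
Qed.

Lemma Gamma_last_jump w t : Gamma w -> 0 <= t ->
  exists m, forall n : nat, (T w n <= t%:E)%E = (n <= m)%N.
Proof.
move=> Gw t0; have [_ T0 T1 _ fin] := Gw; have [s hs] := fin 0 t.
have ex : exists n : nat, (t%:E < T w n.+1)%E.
  (* The successor of this maximum exceeds every index listed by local finiteness on [0, t]; were
     its time at most t, it would be finite and positive, hence listed. *)
  exists (\max_(k <- s) absz k)%N; rewrite ltNge; apply/negP => Tt.
  have Tp : (0 < T w (Posz (\max_(k <- s) absz k).+1))%E by rewrite Gamma_gt0.
  have : Posz (\max_(k <- s) absz k).+1 \in s.
    apply: hs; last by rewrite Tt ltW.
    rewrite fin_numE gt_eqF /=; last by apply: lt_trans Tp; rewrite ltNye.
    by rewrite lt_eqF //; apply: le_lt_trans Tt _; rewrite ltey.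
  move=> sn; have := @leq_bigmax_seq _ s xpredT absz _ sn isT.
  by rewrite /= ltnn.
case: (ex_minnP ex) => m Tm mmin; exists m => n; apply/idP/idP => [Tn|nm].
  rewrite leqNgt; apply/negP => mn; move: Tm; rewrite ltNge => /negP; apply.
  by apply: le_trans Tn; apply: (Gamma_homo Gw).
case: n nm => [_|n nm]; first by apply: le_trans T0 _; rewrite lee_fin.
by rewrite leNgt; apply/negP => /mmin; rewrite leqNgt nm.
Qed.

(** The indices counted by [Ncnt] form an interval starting at 1 and ending at the last jump up to
    t, so on [Gamma] the [xget] never falls back on its default. *)
Lemma le_Ncnt w t n : Gamma w -> 0 <= t ->
  (T w (Posz n) <= t%:E)%E = (n <= Ncnt t w)%N.
Proof.
move=> Gw t0; have [m hm] := Gamma_last_jump Gw t0.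
have hc : hasCount (fun n => 0 < n /\ (0 < T w n <= t%:E)%E) m.
  rewrite -[m]subn0; apply: hasCount_interval => -[k|k]; last first.
    by split=> [[]//|[k' []]].
  split=> [[k0 /andP[_]]|[k' [[->] /andP[k0 km]]]].
    by rewrite hm => km; exists k; split=> //; apply/andP; split.
  by rewrite Gamma_gt0 // hm ltz_nat k0.
rewrite /Ncnt (xget_subset1 _ hc) // => m1 m2; exact: hasCount_inj.
Qed.

Lemma Ncnt_homo w t u : Gamma w -> 0 <= t -> t <= u -> (Ncnt t w <= Ncnt u w)%N.
Proof.
move=> Gw t0 tu; rewrite -le_Ncnt ?(le_trans t0) //.
by apply: (@le_trans _ _ t%:E); rewrite ?lee_fin // le_Ncnt.
Qed.

Lemma Ncnt0 w : Ncnt 0 w = 0%N.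
Proof.
rewrite /Ncnt; apply: xget_subset1; last by move=> m1 m2; exact: hasCount_inj.
exists [::]; split=> // n; split=> // -[_ /andP[h1 h2]].
by have := lt_le_trans h1 h2; rewrite ltxx.
Qed.

(** The law prescribes numbers of points in intervals whereas the walk uses N: for 0 <= a the points
    in ]a, b] are those with index above N(a) and at most N(b). *)
Lemma hasCount_between w a b c : Gamma w -> 0 <= a -> a <= b ->
  hasCount (fun n => (a%:E < T w n <= b%:E)%E) c <-> (Ncnt b w = Ncnt a w + c)%N.
Proof.
move=> Gw a0 ab; have b0 := le_trans a0 ab.
have h : hasCount (fun n => (a%:E < T w n <= b%:E)%E) (Ncnt b w - Ncnt a w).
  apply: hasCount_interval => -[k|k].
    rewrite ltNge !le_Ncnt // -ltnNge; split=> [h|[k' [[->] //]]].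
    by exists k.
  split=> [/andP[aT _]|[k' []] //].
  by have := le_lt_trans (_ : 0%:E <= a%:E)%E aT; rewrite lee_fin a0 Gamma_gt0 // => /(_ isT).
have hm := Ncnt_homo Gw a0 ab; split=> [/(hasCount_inj h) <-|E].
  by rewrite subnKC.
by move: h; rewrite E addKn.
Qed.

(** The process N_g(t), computed from the first N(t) marks. *)
Definition mark_count (g : 'I_M.+1) t w : nat :=
  count (fun n => Y w (Posz n) == g) (iota 1 (Ncnt t w)).

Lemma hasCount_mark w g t m : Gamma w -> 0 <= t ->
  hasCount (fun n => [/\ 0 < n, Y w n = g & (0 < T w n <= t%:E)%E]) m <->
  mark_count g t w = m.
Proof.
move=> Gw t0.
suff h : hasCount (fun n => [/\ 0 < n, Y w n = g & (0 < T w n <= t%:E)%E])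
                  (mark_count g t w).
  by split=> [/(hasCount_inj h)|<-].
exists [seq Posz k | k <- iota 1 (Ncnt t w) & Y w (Posz k) == g]; split.
- by rewrite map_inj_uniq ?filter_uniq ?iota_uniq // => x y [].
- by rewrite size_map size_filter.
move=> n; split=> [/mapP[k]|[n0 Yn Tn]].
  rewrite mem_filter mem_iota => /andP[/eqP Yk /andP[k0 kN]] ->; split=> //.
  by rewrite Gamma_gt0 // le_Ncnt // ltz_nat k0 /=; lia.
case: n n0 Yn Tn => // k k0 Yk /andP[_]; rewrite le_Ncnt // => kN.
apply/mapP; exists k => //; rewrite mem_filter Yk eqxx mem_iota /=.
by rewrite ltz_nat in k0; lia.
Qed.

End Counting.

(** * Measurability of the coordinates, of [Gamma] and of N(t) *)

Section Measurability.
Context {N M : nat} {R : realType}.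
Local Notation Om := (Omega N M R).

Lemma measurable_X0 : fiber_measurable (fun w : Om => X0 w).
Proof. by move=> i; apply: sub_sigma_algebra; left; exists i. Qed.

Lemma measurable_Y n : fiber_measurable (fun w : Om => Y w n).
Proof. by move=> g; apply: sub_sigma_algebra; right; left; exists n, g. Qed.

Lemma measurable_T n : measurable_fun setT (fun w : Om => T w n).
Proof.
move=> _ B mB; rewrite setTI; apply: sub_sigma_algebra; right; right.
by exists n, B.
Qed.

Lemma measurable_T_le n (x : \bar R) : measurable [set w : Om | (T w n <= x)%E].
Proof. by rewrite -[X in measurable X]setTI; apply: emeasurable_fun_infty_c => //; exact: measurable_T. Qed.

Lemma measurable_T_ge n (x : \bar R) : measurable [set w : Om | (x <= T w n)%E].
Proof. by rewrite -[X in measurable X]setTI; apply: emeasurable_fun_c_infty => //; exact: measurable_T. Qed.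

Lemma measurable_T_gt n (x : \bar R) : measurable [set w : Om | (x < T w n)%E].
Proof. by rewrite -[X in measurable X]setTI; apply: emeasurable_fun_o_infty => //; exact: measurable_T. Qed.

Lemma measurable_event_andb (p q : Om -> bool) :
  measurable [set w | p w] -> measurable [set w | q w] ->
  measurable [set w | p w && q w].
Proof.
move=> mp mq; rewrite (_ : [set w | _] = [set w | p w /\ q w]).
  exact: measurable_event_and.
by apply/seteqP; split=> w /= /andP.
Qed.

Lemma measurable_T_between n (a b : \bar R) :
  measurable [set w : Om | (a < T w n <= b)%E].
Proof.
by apply: measurable_event_andb; [exact: measurable_T_gt|exact: measurable_T_le].
Qed.

Lemma measurable_T_lt_succ n : measurable [set w : Om | (T w n < T w (n + 1))%E].
Proof.
rewrite (_ : [set w | _] = [set w : Om | ~ (T w (n + 1) <= T w n)%E]).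
  apply: measurable_event_not; rewrite -[X in measurable X]setTI.
  by apply: measurable_lee => //; exact: measurable_T.
by apply/seteqP; split=> w /=; rewrite ltNge; move/negP.
Qed.

Lemma measurable_T_fin_num n : measurable [set w : Om | T w n \is a fin_num].
Proof.
rewrite -[X in measurable X]setTI; apply: emeasurable_fin_num => //.
exact: measurable_T.
Qed.

Lemma measurable_Gamma : measurable (@Gamma N M R : set Om).
Proof.
(* Integer intervals [-k, k] replace arbitrary real bounds, making all quantifiers countable. *)
pose loc_fin (w : Om) := forall k : nat, exists s : seq int, forall n,
  T w n \is a fin_num -> ((- k%:R)%:E <= T w n <= k%:R%:E)%E -> n \in s.
rewrite (_ : Gamma = [set w : Om |
   (forall n, (T w n <= T w (n + 1))%E) /\ (T w 0 <= 0)%E /\ (0 < T w 1)%E /\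
   (forall n, T w n \is a fin_num -> (T w n < T w (n + 1))%E) /\ loc_fin w]).
  apply: measurable_event_and.
    apply: measurable_event_forall => n; rewrite -[X in measurable X]setTI.
    by apply: measurable_lee => //; exact: measurable_T.
  apply: measurable_event_and; first exact: measurable_T_le.
  apply: measurable_event_and; first exact: measurable_T_gt.
  apply: measurable_event_and.
    apply: measurable_event_forall => n; apply: measurable_event_imply.
      exact: measurable_T_fin_num.
    exact: measurable_T_lt_succ.
  apply: measurable_event_forall => k; apply: measurable_event_exists => s.
  apply: measurable_event_forall => n; apply: measurable_event_imply.
    exact: measurable_T_fin_num.
  apply: measurable_event_imply; last exact: measurable_event_const.
  by apply: measurable_event_andb; [exact: measurable_T_ge|exact: measurable_T_le].
apply/seteqP; split=> w.
  by case=> h1 h2 h3 h4 h5; do !split=> //; move=> k; exact: h5.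
move=> [h1 [h2 [h3 [h4 h5]]]]; split=> // a b.
pose k := maxn (Num.bound `|a|) (Num.bound `|b|).
have [s hs] := h5 k; exists s => n fT /andP[aT Tb]; apply: hs => //.
have hk (x : R) : (Num.bound `|x| <= k)%N -> `|x| <= k%:R :> R.
  move=> xk; apply: le_trans (ltW (archi_boundP (normr_ge0 x))) _; by rewrite ler_nat.
have := hk a (leq_maxl _ _); rewrite ler_norml => /andP[ka _].
have := hk b (leq_maxr _ _); rewrite ler_norml => /andP[_ bk].
apply/andP; split; first by apply: le_trans aT; rewrite lee_fin.
by apply: (le_trans Tb); rewrite lee_fin.
Qed.

Lemma measurable_Ncnt t : fiber_measurable (fun w : Om => Ncnt t w).
Proof.
move=> m.
pose P m (w : Om) := hasCount (fun n => 0 < n /\ (0 < T w n <= t%:E)%E) m.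
have mP k : measurable [set w | P k w].
  apply: measurable_event_hasCount => n; apply: measurable_event_and.
    exact: measurable_event_const.
  exact: measurable_T_between.
(* Off [Gamma] there may be no count at all, and [xget] then returns its default 0. *)
rewrite (_ : [set w | _] = [set w | P m w \/ m = 0%N /\ forall k, ~ P k w]).
  apply: measurable_event_or => //; apply: measurable_event_and.
    exact: measurable_event_const.
  by apply: measurable_event_forall => k; exact: measurable_event_not.
apply/seteqP; split=> w /=; rewrite /Ncnt.
  by case: xgetP => [k -> Pk <-|nP <-]; [left|right].
case=> [Pm|[-> nP]]; last by case: xgetP => // k _ /nP.
by apply: xget_subset1 => // m1 m2; exact: hasCount_inj.
Qed.

End Measurability.

(** * The driven walk and its adaptedness *)

Section Walk.
Context {N M : nat} {R : realType}.
Variable phi : 'I_N.+1 * 'I_M.+1 -> 'I_N.+1 * 'I_M.+1.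
Implicit Types (w : Raw N M R) (t u : R) (s : seq 'I_M.+1).

Definition run (i : 'I_N.+1) s : 'I_N.+1 := foldl (fun j g => (phi (j, g)).1) i s.

(** The block read by the walk after [m] steps; indices start at [m + 1] because index 1 carries the
    first positive time. *)
Definition marks w (m n : nat) : seq 'I_M.+1 := [seq Y w (Posz k) | k <- iota m.+1 n].

Lemma size_marks w m n : size (marks w m n) = n.
Proof. by rewrite size_map size_iota. Qed.

Lemma nth_marks w m n l g : (l < n)%N -> nth g (marks w m n) l = Y w (Posz (m + l).+1).
Proof. by move=> ln; rewrite (nth_map 0%N) ?size_iota // nth_iota // addSn. Qed.

Lemma marks_cat w m n : marks w 0 (m + n) = marks w 0 m ++ marks w m n.
Proof. by rewrite /marks iotaD map_cat add1n. Qed.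

(** Each step rewrites only the mark it reads, so every later mark is still the original one when
    its turn comes. *)
Lemma phi_iterE m (x : 'I_N.+1 * (int -> 'I_M.+1)) :
  (phi_iter phi m x).1 = run x.1 [seq x.2 (Posz k) | k <- iota 1 m] /\
  forall n : nat, (m < n)%N -> (phi_iter phi m x).2 (Posz n) = x.2 (Posz n).
Proof.
elim: m => [//|m [IH1 IH2]]; split=> [|n mn].
  by rewrite -[X in iota 1 X]addn1 iotaD map_cat /run foldl_cat /= -/(run _ _) IH1 IH2 // add1n.
rewrite /= (_ : Posz n == Posz m.+1 = false); first by apply: IH2; exact: ltnW.
by apply/eqP => -[] E; rewrite E ltnn in mn.
Qed.

(** The shift does not touch the state, so [alpha] moves it only through [psi]. *)
Lemma XtE t w : Xt phi t w = run (X0 w) (marks w 0 (Ncnt t w)).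
Proof. by rewrite /Xt /alpha /vartheta /psi [LHS]/=; case: (phi_iterE (Ncnt t w) (X0 w, Y w)). Qed.

Lemma Xt_add u t w : Gamma w -> 0 <= u -> 0 <= t ->
  Xt phi (u + t) w = run (Xt phi u w) (marks w (Ncnt u w) (Ncnt (u + t) w - Ncnt u w)).
Proof.
move=> Gw u0 t0; rewrite !XtE -[in LHS](subnKC (Ncnt_homo Gw u0 (_ : u <= u + t))) ?lerDl //.
by rewrite marks_cat /run foldl_cat.
Qed.

Lemma sum_mark_count t w : (\sum_g mark_count g t w = Ncnt t w)%N.
Proof.
rewrite /mark_count.
under eq_bigr => g _.
  rewrite -sum1_count big_mkcond /=.
  over.
rewrite exchange_big /=.
under eq_bigr => k _.
  rewrite (bigD1 (Y w (Posz k))) //= eqxx big1 ?addn0; last first.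
    by move=> g; rewrite eq_sym => /negPf ->.
  over.
by rewrite sum1_size size_iota.
Qed.

Lemma mark_count_marks g t w :
  mark_count g t w = count_mem g (marks w 0 (Ncnt t w)).
Proof. by rewrite /mark_count /marks count_map; apply: eq_count. Qed.

Lemma count_marksS g m w :
  count_mem g (marks w 0 m.+1) = (count_mem g (marks w 0 m) + (Y w (Posz m.+1) == g))%N.
Proof. by have := marks_cat w m 1; rewrite [X in marks w 0 X]addn1 => ->; rewrite count_cat /= addn0. Qed.

(** Finite jump times increase strictly, so N keeps each level on an interval that contains a
    rational. The absolute value and the minimum force the evaluation time into [0, t] for every
    [q], which keeps the search for it countable. *)
Lemma Ncnt_rational_time w t l : Gamma w -> 0 <= t -> (l <= Ncnt t w)%N ->
  exists q : rat, Ncnt (Num.min t `|ratr q|) w = l.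
Proof.
move=> Gw t0; rewrite leq_eqVlt => /orP[/eqP ->|lN].
  (* The level N(t) is attained at t itself: a rational above t is truncated to t. *)
  have [q] := @rat_in_itvoo R t (t + 1) (ltr_pwDr ltr01 (lexx t)).
  rewrite in_itv /= => /andP[tq _]; exists q.
  by rewrite ger0_norm ?(le_trans t0) // ?min_l // ltW.
have : (T w l.+1 <= t%:E)%E by rewrite le_Ncnt.
have : (0 < T w l.+1)%E by rewrite Gamma_gt0.
case E: (T w l.+1) => [r| |] //=; rewrite ?leye_eq // lte_fin lee_fin => r0 rt.
(* N stays at level l from [a] up to the next jump r; [a] is cut off at 0 because the time of index
   0 may be negative or -oo. *)
have [a [a0 ar Ta]] : exists a : R, [/\ 0 <= a, a < r & (T w l <= a%:E)%E].
  have [_ T0 _ strict _] := Gw.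
  have := Gamma_homo Gw (_ : (Posz l <= Posz l.+1)%R); rewrite E => /(_ _) Tlr.
  case El: (T w l) => [x| |] //.
  - have := strict l; rewrite El => /(_ isT).
    rewrite (_ : (Posz l + 1)%R = Posz l.+1) ?E ?lte_fin => [xr|]; last by lia.
    exists (Num.max 0 x); split; rewrite ?lee_fin ?le_max ?lexx ?orbT //.
    by rewrite gt_max r0.
  - by have := Tlr (leqnSn l); rewrite El leye_eq.
  - by exists 0; rewrite leNye.
have [q] := rat_in_itvoo ar; rewrite in_itv /= => /andP[aq qr]; exists q.
have q0 : 0 <= ratr q :> R by apply: le_trans a0 (ltW aq).
rewrite ger0_norm // min_r ?(le_trans (ltW qr)) //; apply/eqP.
rewrite eqn_leq -le_Ncnt // (le_trans Ta) ?lee_fin ?ltW // andbT leqNgt.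
by rewrite -le_Ncnt // E lee_fin -ltNge.
Qed.

Definition counting_event u (c : {ffun 'I_M.+1 -> nat}) w : Prop :=
  forall g, hasCount (fun n => [/\ 0 < n, Y w n = g & (0 < T w n <= u%:E)%E]) (c g).

(* The marks up to time [t] are recovered from the counting processes by
   evaluating these at rational times separating consecutive jumps. *)
Lemma Xt_adapted t i : 0 <= t ->
  exists A : set (Raw N M R), Filt t A /\
    A `&` Gamma = [set w | Xt phi t w = i] `&` Gamma.
Proof.
move=> t0; pose tau (q : rat) : R := Num.min t `|ratr q|.
have tau0 q : 0 <= tau q by rewrite le_min t0 normr_ge0.
have taut q : tau q <= t by rewrite ge_min lexx.
pose Ft := g_sigma_algebraType (@filtGen N M R t).
(* Between a time with l jumps and one with l + 1 jumps, exactly one N_g increases; its g is the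
   mark of index l + 1, stored at position l of [s]. *)
pose sep (w : Ft) s (l : nat) (q q' : rat) (c c' : {ffun 'I_M.+1 -> nat}) :=
  ((\sum_g c g = l)%N /\ (\sum_g c' g = l.+1)%N /\
   c' (nth ord0 s l) = (c (nth ord0 s l)).+1) /\
  counting_event (tau q) c w /\ counting_event (tau q') c' w.
(* [s] is a candidate for the list of marks up to t. All quantifiers range over countable types, so
   [A] is built from generators by countable operations. *)
pose A : set Ft := [set w | exists s, (exists k, X0 w = k /\ run k s = i) /\
  (exists c : {ffun 'I_M.+1 -> nat}, (\sum_g c g = size s)%N /\ counting_event t c w) /\
  forall l : nat, (l < size s)%N -> exists q q' c c', sep w s l q q' c c'].
exists A; split.
  have mcount c u : 0 <= u <= t -> measurable [set w : Ft | counting_event u c w].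
    move=> ut; apply: measurable_event_forall => g; apply: sub_sigma_algebra.
    by right; exists g, u, (c g).
  have mA : measurable A.
    apply: measurable_event_exists => s; apply: measurable_event_and.
      apply: measurable_event_exists => k; apply: measurable_event_and.
        by apply: sub_sigma_algebra; left; exists k.
      exact: measurable_event_const.
    apply: measurable_event_and.
      apply: measurable_event_exists => c; apply: measurable_event_and.
        exact: measurable_event_const.
      by apply: mcount; rewrite t0 lexx.
    apply: measurable_event_forall => l.
    apply: measurable_event_imply; first exact: measurable_event_const.
    apply: measurable_event_exists => q; apply: measurable_event_exists => q'.
    apply: measurable_event_exists => c; apply: measurable_event_exists => c'.
    apply: measurable_event_and; first exact: measurable_event_const.
    by apply: measurable_event_and; apply: mcount; rewrite tau0 taut.
  exact: mA.
apply/seteqP; split=> w [Aw Gw]; split=> //=; last first.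
  have cE u (c : {ffun 'I_M.+1 -> nat}) : 0 <= u -> (forall g, c g = mark_count g u w) -> counting_event u c w.
    by move=> u0 hc g; apply/hasCount_mark => //; rewrite hc.
  exists (marks w 0 (Ncnt t w)); split; first by exists (X0 w); rewrite -XtE.
  split.
    exists [ffun g => mark_count g t w]; split.
      rewrite size_marks -[RHS]sum_mark_count.
      by apply: eq_bigr => g _; rewrite ffunE.
    by apply: cE => // g; rewrite ffunE.
  move=> l; rewrite size_marks => lN.
  have [q qE] := Ncnt_rational_time Gw t0 (ltnW lN).
  have [q' q'E] := Ncnt_rational_time Gw t0 lN.
  exists q, q', [ffun g => mark_count g (tau q) w], [ffun g => mark_count g (tau q') w].
  split; last by split; apply: cE => // g; rewrite ffunE.
  split; first by rewrite -qE -sum_mark_count; apply: eq_bigr => g _; rewrite ffunE.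
  split; first by rewrite -q'E -sum_mark_count; apply: eq_bigr => g _; rewrite ffunE.
  by rewrite !ffunE !mark_count_marks qE q'E nth_marks // add0n count_marksS eqxx addn1.
(* The candidate must be the true list: the total at time t fixes its length and the separating
   times fix each entry. *)
case: Aw => s [[k [<- <-]] [[c [csz ct]] hs]]; rewrite XtE; congr run.
have NE u (c' : {ffun 'I_M.+1 -> nat}) : 0 <= u -> counting_event u c' w ->
    (\sum_g c' g = Ncnt u w)%N /\ forall g, mark_count g u w = c' g.
  move=> u0 h; have hg g : mark_count g u w = c' g by apply/hasCount_mark => //; exact: h.
  by split=> //; rewrite -sum_mark_count; apply: eq_bigr.
have [NtE _] := NE _ _ t0 ct; rewrite csz in NtE.
apply: (@eq_from_nth _ ord0); rewrite size_marks -NtE // => l ls.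
rewrite nth_marks // add0n.
have [q [q' [c1 [c2 [[s1 [s2 c12]] [h1 h2]]]]]] := hs l ls.
have [N1 m1] := NE _ _ (tau0 q) h1; have [N2 m2] := NE _ _ (tau0 q') h2.
rewrite -m1 -m2 !mark_count_marks -N1 -N2 s1 s2 count_marksS -[RHS]addn1 in c12.
by apply/eqP; move/eqP: c12; rewrite eqn_add2l eqb1.
Qed.

End Walk.

(** * Independence of the future marks and jumps *)

Section Fibers.
Context d (T : measurableType d) (R : realType) (P : probability T R).
Implicit Types A B : set T.

Lemma measure_nat_fibers A (g : T -> nat) : measurable A -> fiber_measurable g ->
  P A = (\sum_(0 <= n <oo) P (A `&` [set w | g w = n]))%E.
Proof.
move=> mA mg; rewrite -measure_semi_bigcup.
- congr (P _); apply/seteqP; split=> w; first by move=> Aw; exists (g w).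
  by case=> n _ [].
- by move=> n; apply: measurableI => //; exact: mg.
- by move=> m n _ _ [w [[_ /= <-] [_ /= <-]]].
- apply: bigcup_measurable => n _; apply: measurableI => //; exact: mg.
Qed.

(** Countable additivity over the fibers of [f], numbered by [pickle]; numbers that code no value
    contribute empty sets. *)
Lemma measure_fibers_scale (C : countType) (f : T -> C) A B (r : R) :
  measurable A -> measurable B -> fiber_measurable f ->
  (forall c, P (A `&` [set w | f w = c]) = (P (B `&` [set w | f w = c]) * r%:E)%E) ->
  P A = (P B * r%:E)%E.
Proof.
move=> mA mB mf fAB; have mg := fiber_measurable_comp (@pickle C) mf.
rewrite (measure_nat_fibers mA mg) (measure_nat_fibers mB mg) muleC -nneseriesZl //.
apply: eq_eseriesr => n _; rewrite muleC.
have [[c cn]|nc] := pselect (exists c : C, pickle c = n).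
  rewrite -cn (_ : [set w | pickle (f w) = _] = [set w | f w = c]) ?fAB //.
  apply/seteqP; split=> w /= => [|-> //].
  by move/(pcan_inj pickleK).
rewrite (_ : [set w | pickle (f w) = _] = set0) ?setI0 ?measure0 ?mul0e //.
by apply/seteqP; split=> w //= fw; apply: nc; exists (f w).
Qed.

Lemma measure_fin_fibers (C : finType) (Q : pred C) (F : C -> set T) A :
  (forall c, measurable (F c)) -> trivIset setT F ->
  A = \bigcup_(c in [set c | Q c]) F c ->
  P A = (\sum_(c | Q c) P (F c))%E.
Proof.
move=> mF tF ->; rewrite measure_fin_bigcup //.
- rewrite (_ : [set c | Q c] = [set` Q]) // -(@bigfs _ _ _ _ (index_enum C)) //.
    exact: index_enum_uniq.
  by move=> c _; rewrite mem_index_enum.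
- exact: finite_finset.
- by apply: sub_trivIset tF.
Qed.

(** For fixed [B1], [B2] and [r] the sets satisfying the identity form a Dynkin system; stability
    under complement uses the identity for [setT]. *)
Lemma g_sigma_algebra_scale (G : set (set T)) B1 B2 (r : R) :
  setI_closed G -> G setT -> G `<=` measurable -> measurable B1 -> measurable B2 ->
  (forall A, G A -> P (A `&` B1) = (P (A `&` B2) * r%:E)%E) ->
  forall A, <<s G >> A -> P (A `&` B1) = (P (A `&` B2) * r%:E)%E.
Proof.
move=> GI GT Gm mB1 mB2 hG A.
pose H := [set A | measurable A /\ P (A `&` B1) = (P (A `&` B2) * r%:E)%E].
suff GH : <<s G >> `<=` H by move=> /GH[].
rewrite -setI_closed_g_dynkin_g_sigma_algebra //; apply: smallest_sub; last first.
  by move=> X GX; split; [exact: Gm|exact: hG].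
have PT : P B1 = (P B2 * r%:E)%E by have := hG _ GT; rewrite !setTI.
have finP X : measurable X -> P X \is a fin_num by move=> ?; exact: fin_num_measure.
split.
- by split=> //; rewrite !setTI.
- move=> X [mX hX]; split; first exact: measurableC.
  have compl_part B : measurable B -> P (~` X `&` B) = (P B - P (X `&` B))%E.
    move=> mB; rewrite setIC -setDE measureD //; first by rewrite [B `&` X]setIC.
    by rewrite -ge0_fin_numE // finP.
  rewrite !compl_part // PT hX muleBl //.
  by apply: fin_num_adde_defr; exact: finP.
- move=> F tF hF; have mF n : measurable (F n) by case: (hF n).
  split; first exact: bigcupT_measurable.
  have sumE B : measurable B ->
      P (\bigcup_n F n `&` B) = (\sum_(0 <= n <oo) P (F n `&` B))%E.
    move=> mB; rewrite setI_bigcupl measure_semi_bigcup //.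
    - by move=> n; exact: measurableI.
    - exact: trivIset_setIr.
    - by apply: bigcupT_measurable => n; exact: measurableI.
  rewrite !sumE // muleC -nneseriesZl //; apply: eq_eseriesr => n _.
  by rewrite muleC; case: (hF n).
Qed.

End Fibers.

Lemma sum_tuple_cons (R : nmodType) (G : finType) n (F : seq G -> R) (Q : pred (seq G)) :
  \sum_(h : n.+1.-tuple G | Q h) F h =
  \sum_g \sum_(h : n.-tuple G | Q (g :: h)) F (g :: h).
Proof.
rewrite pair_big_dep /= (reindex (fun p : G * n.-tuple G => cons_tuple p.1 p.2)) //=.
exists (fun h : n.+1.-tuple G => (thead h, behead_tuple h)) => [[g h] _|h _] /=.
  by congr pair; apply/val_inj.
by apply/val_inj; rewrite /= [in RHS](tuple_eta h).
Qed.

(** Chapman-Kolmogorov by induction: the first mark leads from i to an intermediate state, and the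
    remaining marks drive the walk from there. *)
Lemma run_law (R : realType) (N M : nat) (phi : 'I_N.+1 * 'I_M.+1 -> 'I_N.+1 * 'I_M.+1)
    (q : 'I_M.+1 -> R) (Pm : 'M[R]_N.+1) :
  (forall i j, \sum_(g | (phi (i, g)).1 == j) q g = Pm i j) ->
  forall n i j, \sum_(h : n.-tuple 'I_M.+1 | run phi i h == j) \prod_(g <- h) q g =
    (Pm ^+ n) i j.
Proof.
move=> hq; elim=> [|n IH] i j.
  rewrite expr0 mxE big_mkcond (big_pred1 [tuple]) /= => [|h]; last by apply/esym/eqP; exact: tuple0.
  by rewrite big_nil; case: eqP.
rewrite exprS mxE (sum_tuple_cons n (fun h => \prod_(g <- h) q g) (fun h => run phi i h == j)).
under [RHS]eq_bigr => k _ do rewrite -hq mulr_suml.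
rewrite [RHS](exchange_big_dep predT) //=; apply: eq_bigr => g _.
rewrite [RHS](big_pred1 ((phi (i, g)).1)) => [|k]; last by rewrite eq_sym.
rewrite -IH mulr_sumr; apply: eq_bigr => h _.
by rewrite big_cons.
Qed.

(** * Cylinder probabilities and independence of the future under the law *)

Section Law.
Context {N M : nat} {R : realType}.
Variables (k : 'I_N.+1) (q : 'I_M.+1 -> R) (lam : R).
Variable P : probability (Omega N M R) R.
Hypothesis law : law_Pk k q lam P.
Local Notation Om := (Omega N M R).
Local Notation Gam := (@Gamma N M R : set Om).
Implicit Types (A B : set Om) (w : Om) (s t u : R) (L U : seq R).

Lemma measurable_marks m n : fiber_measurable (fun w : Om => marks w m n).
Proof. by apply: fiber_measurable_map => l; exact: measurable_Y. Qed.

Lemma measurable_past_marks t : fiber_measurable (fun w : Om => marks w 0 (Ncnt t w)).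
Proof.
apply: (fiber_measurable_dep (h := fun n w => marks w 0 n)); first exact: measurable_Ncnt.
by move=> n; exact: measurable_marks.
Qed.

Lemma prob_Gamma A : measurable A -> P (A `&` Gam) = P A.
Proof.
move=> mA; have mG := @measurable_Gamma N M R.
suff D0 : P (A `\` Gam) = 0%E by rewrite [RHS](measureDI P mA mG) [X in (X + _)%E]D0 add0e.
apply: (@subset_measure0 _ _ _ _ _ (~` Gam)).
- exact: measurableD.
- exact: measurableC.
- by move=> w [].
- by rewrite /= probability_setC // law.1 subee.
Qed.

Lemma prob_start : P [set w | X0 w = k] = 1%E.
Proof.
have := law.2 [::] (fun=> ord0) 0%N (fun=> 0) (fun=> 0%N) isT (fun _ _ => lexx _).
rewrite big_nil big_ord0 mulr1 => <-; congr (P _).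
by apply/seteqP; split=> w => [//|[]].
Qed.

Lemma prob_not_start A : measurable A -> A `<=` [set w | X0 w <> k] -> P A = 0%E.
Proof.
move=> mA Ak; have mk := measurable_X0 k : measurable [set w : Om | X0 w = k].
apply: subset_measure0 Ak _ => //; first exact: measurable_event_not.
suff : P (~` [set w : Om | X0 w = k]) = 0%E by [].
by rewrite probability_setC // prob_start subee.
Qed.

(** The joint Poisson weight of N taking the values [cs] at the times [L], through independent
    increments; the prepended zeros encode N(0) = 0. *)
Definition increment_weight L (cs : seq nat) : R :=
  \prod_(j < size L)
    poisson_weight (lam * (nth 0 L j - nth 0 (0 :: L) j))
                   (nth 0%N cs j - nth 0%N (0%N :: cs) j).

Lemma increment_weight_rcons L cs u c : size cs = size L ->
  increment_weight (rcons L u) (rcons cs c) =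
  increment_weight L cs * poisson_weight (lam * (u - last 0 L)) (c - last 0%N cs).
Proof.
move=> sz; rewrite /increment_weight size_rcons big_ord_recr /=; congr (_ * _).
  apply: eq_bigr => j _; rewrite -!rcons_cons !nth_rcons /= sz !ltnS.
  by rewrite !ltn_ord !(ltnW (ltn_ord j)).
rewrite -!rcons_cons !nth_rcons /= sz !ltnn !eqxx !ltnSn.
by rewrite (last_nth 0) (last_nth 0%N) sz.
Qed.

Definition cylinder L (ys : seq 'I_M.+1) (cs : seq nat) : set Om :=
  [set w | [/\ X0 w = k, marks w 0 (size ys) = ys & [seq Ncnt u w | u <- L] = cs]].

(** On [Gamma], the values of N at the times of [L] and its increments over consecutive intervals
    determine each other, and the law gives the probability in terms of the increments. *)
Lemma law_cylinder L ys cs : path <=%R 0 L -> path leq 0%N cs -> size cs = size L ->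
  P (cylinder L ys cs `&` Gam) = ((\prod_(g <- ys) q g) * increment_weight L cs)%:E.
Proof.
move=> sL scs sz.
pose S := [seq Posz l | l <- iota 1 (size ys)].
pose g (n : int) := nth ord0 ys (absz n).-1.
pose a j := nth 0 (0 :: L) j; pose d j := nth 0%N (0%N :: cs) j.
pose c j := (d j.+1 - d j)%N.
have aS j : (j < size L)%N -> a j <= a j.+1 by move=> jL; exact: (pathP 0 sL).
have dS j : (j < size L)%N -> (d j <= d j.+1)%N.
  by move=> jL; apply: (pathP 0%N scs); rewrite sz.
have a_ge0 j : (j <= size L)%N -> 0 <= a j.
  by elim: j => // j IH jL; apply: le_trans (aS _ jL); exact: IH (ltnW jL).
have uS : uniq S by rewrite map_inj_uniq ?iota_uniq // => x y [].
have -> : \prod_(h <- ys) q h = \prod_(n <- S) q (g n).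
  rewrite big_map (big_nth ord0) /index_iota subn0 -[1%N]add1n iotaDl big_map.
  by apply: eq_bigr.
pose D : set Om := [set w | [/\ X0 w = k, (forall n, n \in S -> Y w n = g n) &
  forall j, (j < size L)%N ->
    hasCount (fun n => ((a j)%:E < T w n <= (a j.+1)%:E)%E) (c j)]].
have mD : measurable D.
  rewrite (_ : D = [set w : Om | X0 w = k /\ (forall n, n \in S -> Y w n = g n) /\
      forall j, (j < size L)%N ->
        hasCount (fun n => ((a j)%:E < T w n <= (a j.+1)%:E)%E) (c j)]); last first.
    by apply/seteqP; split=> w /= => [[? ? ?]|[? [? ?]]].
  apply: measurable_event_and; first exact: measurable_X0.
  apply: measurable_event_and; apply: measurable_event_forall => n;
    (apply: measurable_event_imply; first exact: measurable_event_const).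
    exact: measurable_Y.
  by apply: measurable_event_hasCount => l; exact: measurable_T_between.
transitivity (P D); last exact: (law.2 S g (size L) a c uS aS).
rewrite -(prob_Gamma mD).
congr (P _); apply/seteqP; split=> w [[Xk hY hN] Gw]; split=> //; split=> //.
- move=> n /mapP[l]; rewrite mem_iota => /andP[l0 ls] ->.
  case: l l0 ls => // l _; rewrite add1n ltnS => ls.
  by rewrite /g /= -hY nth_marks.
- move=> j jL; rewrite (hasCount_between _ Gw) ?aS ?a_ge0 //; last exact: ltnW.
  have dN i : (i <= size L)%N -> Ncnt (a i) w = d i.
    case: i => [_|i iL]; first by rewrite /a /= Ncnt0.
    by rewrite /a /d /= -hN (nth_map 0).
  by rewrite !dN ?subnKC ?dS // ltnW.
- apply: (@eq_from_nth _ ord0); rewrite size_marks // => l ls.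
  rewrite nth_marks // add0n hY //.
  by apply/mapP; exists l.+1 => //; rewrite mem_iota.
- have dN i : (i <= size L)%N -> Ncnt (a i) w = d i.
    elim: i => [_|i IH iL]; first by rewrite /a /= Ncnt0.
    have := hN i iL; rewrite (hasCount_between _ Gw) ?aS ?a_ge0 //; last exact: ltnW.
    by rewrite IH ?(ltnW iL) // subnKC // dS.
  apply: (@eq_from_nth _ 0%N); rewrite size_map ?sz // => j jL.
  by rewrite (nth_map 0) //; exact: (dN j.+1).
Qed.

(* On [Gamma], [A] depends only on the initial state, the marks up to time [s]
   and the values of [N] at finitely many times of [[0, s]].  These sets are
   stable under intersection, unlike the generators of [Filt s]. *)
Definition determined s A : Prop :=
  measurable A /\ exists U, all (fun u => 0 <= u <= s) U /\
    forall w w', Gam w -> Gam w' -> X0 w = X0 w' ->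
      marks w 0 (Ncnt s w) = marks w' 0 (Ncnt s w') ->
      [seq Ncnt u w | u <- U] = [seq Ncnt u w' | u <- U] -> A w -> A w'.

Lemma determinedT s : determined s setT.
Proof. by split=> //; exists [::]. Qed.

Lemma determinedI s : setI_closed (determined s).
Proof.
move=> A B [mA [U [Us hA]]] [mB [V [Vs hB]]]; split; first exact: measurableI.
exists (U ++ V); split; first by rewrite all_cat Us.
move=> w w' Gw Gw' X Y'; rewrite !map_cat => /eqP; rewrite eqseq_cat ?size_map //.
by move=> /andP[/eqP EU /eqP EV] [Aw Bw]; split; [exact: hA EU _|exact: hB EV _].
Qed.

(** For s, t >= 0 these events are disjoint for distinct words [h] and cover [Gamma]. *)
Definition future_event s t (h : seq 'I_M.+1) : set Om :=
  [set w | Ncnt (s + t) w = (Ncnt s w + size h)%N /\ marks w (Ncnt s w) (size h) = h].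

Lemma measurable_future_event s t h : measurable (future_event s t h).
Proof.
apply: measurable_event_and.
  apply: (fiber_measurable_event (P := fun c w => Ncnt (s + t) w = (c + size h)%N)).
    exact: measurable_Ncnt.
  by move=> c; exact: measurable_Ncnt.
apply: (fiber_measurable_event (P := fun c w => marks w c (size h) = h)).
  exact: measurable_Ncnt.
by move=> c; exact: measurable_marks.
Qed.

(** On each cell of fixed past data, [A] is a cylinder and the future event extends it by one time
    and one block of marks; the weights differ exactly by the stated factor, which is the same for
    all cells. *)
Lemma determined_future_indep s t h A : 0 <= s -> 0 <= t -> determined s A ->
  P (A `&` Gam `&` future_event s t h) =
  (P (A `&` Gam) * (poisson_weight (lam * t) (size h) * \prod_(g <- h) q g)%:E)%E.
Proof.
move=> s0 t0 [mA [U [Us hA]]].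
have mAG : measurable (A `&` Gam) by apply: measurableI => //; exact: measurable_Gamma.
have mE := measurable_future_event s t h.
(* Sorting makes the increments consecutive; [s] comes last, so that s + t can be appended. *)
pose L := rcons (sort <=%R U) s.
pose f w := (X0 w, marks w 0 (Ncnt s w), [seq Ncnt u w | u <- L]).
have mf : fiber_measurable f.
  apply: fiber_measurable_pair; first apply: fiber_measurable_pair.
  - exact: measurable_X0.
  - exact: measurable_past_marks.
  - by apply: fiber_measurable_map => u; exact: measurable_Ncnt.
apply: (measure_fibers_scale _ _ mf) => //; first exact: measurableI.
move=> z; have [[w0 [[Aw0 Gw0] fw0]]|nz] :=
  pselect (exists w0, (A `&` Gam) w0 /\ f w0 = z); last first.
  rewrite (_ : A `&` Gam `&` [set w | f w = z] = set0); last first.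
    by apply/seteqP; split=> w // [AGw fw]; apply: nz; exists w.
  rewrite (_ : _ `&` _ = set0) ?measure0 ?mul0e //.
  by apply/seteqP; split=> w // [[AGw _] fw]; apply: nz; exists w.
have mfz : measurable [set w | f w = z] by exact: mf.
(* Under the law the initial state is almost surely k, so any other cell is null on both sides. *)
have [Xk|Xk] := pselect (X0 w0 = k); last first.
  have fk w : f w = z -> X0 w <> k by rewrite -fw0 => -[-> _ _].
  have null B : measurable B -> P (B `&` [set w | f w = z]) = 0%E.
    move=> mB; apply: prob_not_start; first exact: measurableI.
    by move=> w [_ /= fw]; exact: fk.
  by rewrite !null ?mul0e //; exact: measurableI.
pose ys := marks w0 0 (Ncnt s w0); pose cs := [seq Ncnt u w0 | u <- L].
have szy : size ys = Ncnt s w0 by rewrite size_marks.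
have Ns w : [seq Ncnt u w | u <- L] = cs -> Ncnt s w = size ys.
  by move/eq_in_map => hN; rewrite szy; apply: hN; rewrite mem_rcons in_cons eqxx.
(* The cell contains [w0] from [A], and [f] records all the data on which [A] depends, so within
   [Gamma] the whole cell lies in [A]. *)
have cylE w : Gam w -> (A w /\ f w = z) <-> cylinder L ys cs w.
  move=> Gw; split=> [[Aw]|[Xw mw Nw]].
    rewrite -fw0 => -[Xw mw Nw]; split=> //; first by rewrite Xw.
    by rewrite -(Ns _ Nw) mw.
  have mw' : marks w 0 (Ncnt s w) = marks w0 0 (Ncnt s w0) by rewrite (Ns w Nw) mw.
  have XE : X0 w = X0 w0 by rewrite Xw Xk.
  split; last by rewrite -fw0 /f XE mw' Nw.
  apply: (hA w0 w) => //; apply/eq_in_map => u uU; symmetry.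
  move/eq_in_map: Nw => Nw; apply: Nw.
  by rewrite mem_rcons in_cons mem_sort uU orbT.
have cylE' w : Gam w -> (cylinder L ys cs w /\ future_event s t h w) <->
    cylinder (rcons L (s + t)) (ys ++ h) (rcons cs (size ys + size h)) w.
  move=> Gw; rewrite /cylinder /= map_rcons size_cat marks_cat; split.
    move=> [[Xw mw Nw] [Nw' hw]]; split=> //; last by rewrite Nw Nw' (Ns w Nw).
    by rewrite mw -(Ns w Nw) hw.
  move=> [Xw /eqP mw /rcons_inj[Nw Nw']].
  move: mw; rewrite eqseq_cat ?size_marks // => /andP[/eqP mw /eqP hw].
  split; first by split; rewrite ?szy.
  by split; rewrite (Ns w Nw) // szy.
have sL : path <=%R 0 L.
  rewrite rcons_path; apply/andP; split.
    rewrite path_min_sorted; first exact: sort_le_sorted.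
    by rewrite all_sort; apply: sub_all Us => u /andP[].
  have := mem_last 0 (sort <=%R U); rewrite in_cons mem_sort => /orP[/eqP -> //|].
  by move=> /(allP Us)/andP[].
have scs : path leq 0%N cs.
  rewrite (_ : path _ _ _ = path (relpre (Ncnt^~ w0) leq) 0 L); last first.
    by rewrite -path_map /= Ncnt0.
  have /(pathP 0) hL := sL; apply/(pathP 0) => j jL /=.
  apply: Ncnt_homo => //; last exact: hL.
  have : nth 0 (0 :: L) j \in 0 :: L by rewrite mem_nth //= ltnS ltnW.
  by move/(order_path_min le_trans)/allP: sL => L0; rewrite in_cons => /orP[/eqP->|/L0].
have szcs : size cs = size L by rewrite size_map.
have lastL : last 0 L = s by rewrite last_rcons.
have lastc : last 0%N cs = size ys by rewrite /cs map_rcons last_rcons szy.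
rewrite (_ : A `&` Gam `&` [set w | f w = z] = cylinder L ys cs `&` Gam); last first.
  apply/seteqP; split=> w [].
    by move=> [Aw Gw] fw; split=> //; apply/cylE.
  by move=> /cylE h1 Gw; case: (h1 Gw).
rewrite (_ : _ `&` future_event s t h `&` _ =
   cylinder (rcons L (s + t)) (ys ++ h) (rcons cs (size ys + size h)) `&` Gam); last first.
  apply/seteqP; split=> w [].
    by move=> [[Aw Gw] Ew] fw; split=> //; apply/cylE' => //; split=> //; apply/cylE.
  by move=> cw Gw; have [/(cylE _ Gw)[Aw fw] Ew] := (cylE' w Gw).2 cw.
have sL' : path <=%R 0 (rcons L (s + t)) by rewrite rcons_path sL lastL lerDl.
have szcs' : size (rcons cs (size ys + size h)) = size (rcons L (s + t)).
  by rewrite [LHS]size_rcons [RHS]size_rcons szcs.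
have scs' : path leq 0%N (rcons cs (size ys + size h)).
  by rewrite rcons_path scs lastc leq_addr.
rewrite (law_cylinder _ sL scs szcs) (law_cylinder _ sL' scs' szcs').
rewrite increment_weight_rcons // lastL lastc addKn big_cat /=.
rewrite (_ : s + t - s = t); last by rewrite addrC addrA addNr add0r.
by rewrite -EFinM; congr EFin; ring.
Qed.

End Law.

(** * The Markov property *)

Section Markov.
Context {N M : nat} {R : realType}.
Variable phi : 'I_N.+1 * 'I_M.+1 -> 'I_N.+1 * 'I_M.+1.
Local Notation Om := (Omega N M R).
Local Notation Gam := (@Gamma N M R : set Om).
Implicit Types (A : set Om) (w : Om) (s t : R).

Lemma marks_take w m n : (m <= n)%N -> marks w 0 m = take m (marks w 0 n).
Proof.
by move=> mn; rewrite -(subnKC mn) marks_cat take_size_cat // size_marks.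
Qed.

Lemma measurable_Xt t : fiber_measurable (fun w : Om => Xt phi t w).
Proof.
rewrite (_ : (fun w : Om => _) = fun w : Om => run phi (X0 w) (marks w 0 (Ncnt t w))).
  apply: (fiber_measurable_comp (f := fun w : Om => (X0 w, marks w 0 (Ncnt t w)))
            (fun z => run phi z.1 z.2)).
  apply: fiber_measurable_pair; first exact: measurable_X0.
  exact: measurable_past_marks.
by apply/funext => w; rewrite XtE.
Qed.

Lemma determined_Xt s i : determined s [set w : Om | Xt phi s w = i].
Proof.
split; first exact: measurable_Xt.
by exists [::]; split=> // w w' _ _ X E _ /=; rewrite !XtE X E.
Qed.

(** For u <= s, N_g(u) counts g among the first N(u) marks, a prefix of the marks up to s; knowing
    N(u) in addition to those marks is enough. *)
Lemma determined_filtGen s A : filtGen s A -> determined s A.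
Proof.
case=> [[i ->]|[g [u [m [/andP[u0 us] ->]]]]].
  split; first exact: measurable_X0.
  by exists [::]; split=> // w w' _ _ /= ->.
split.
  apply: measurable_event_hasCount => n.
  rewrite (_ : [set w : Om | _] = [set w : Om | 0 < n /\ Y w n = g /\
      (0 < T w n <= u%:E)%E]); last first.
    by apply/seteqP; split=> w /= => [[? ? ?]|[? [? ?]]].
  apply: measurable_event_and; first exact: measurable_event_const.
  by apply: measurable_event_and; [exact: measurable_Y|exact: measurable_T_between].
exists [:: u]; split; first by rewrite /= u0 us.
move=> w w' Gw Gw' _ E [Nu] /= /hasCount_mark h; apply/hasCount_mark => //.
rewrite -(h Gw u0) !mark_count_marks (marks_take w' (Ncnt_homo Gw' u0 us)).
by rewrite (marks_take w (Ncnt_homo Gw u0 us)) E Nu.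
Qed.

Variables (k : 'I_N.+1) (q : 'I_M.+1 -> R) (lam : R) (Pm : 'M[R]_N.+1).
Variable P : probability Om R.
Hypothesis law : law_Pk k q lam P.
Hypothesis lam0 : 0 <= lam.
Hypothesis stP : stochastic Pm.
Hypothesis qP : forall i j, \sum_(g | (phi (i, g)).1 == j) q g = Pm i j.

(** Splitting by the number n of jumps in ]s, s + t] and then by their marks, independence gives a
    Poisson weight and [run_law] gives Pm^n; the sum over n is the Poisson mixture for the
    exponential. *)
Lemma determined_markov s t A i j : 0 <= s -> 0 <= t -> determined s A ->
  P (A `&` (Gam `&` [set w | Xt phi s w = i /\ Xt phi (s + t) w = j])) =
  (P (A `&` (Gam `&` [set w | Xt phi s w = i])) *
     (expmx t (lam *: (Pm - 1)) i j)%:E)%E.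
Proof.
move=> s0 t0 dA; have mG := @measurable_Gamma N M R.
(* The present state is itself determined by the past data, so it can be absorbed into [A]. *)
pose B := A `&` [set w : Om | Xt phi s w = i].
have dB : determined s B by apply: determinedI => //; exact: determined_Xt.
have mBG : measurable (B `&` Gam) by apply: measurableI => //; case: dB.
have -> : A `&` (Gam `&` [set w | Xt phi s w = i]) = B `&` Gam.
  by rewrite /B setIAC setIA.
have -> : A `&` (Gam `&` [set w | Xt phi s w = i /\ Xt phi (s + t) w = j]) =
    B `&` Gam `&` [set w : Om | Xt phi (s + t) w = j].
  by apply/seteqP; split=> w /= => [[? [? []]]|[[[]]]].
have [p pE] : exists p, P (B `&` Gam) = p%:E.
  by exists (fine (P (B `&` Gam))); rewrite fineK // fin_num_measure.
rewrite pE; pose jumps (w : Om) := (Ncnt (s + t) w - Ncnt s w)%N.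
have mjumps : fiber_measurable jumps.
  apply: (fiber_measurable_comp (f := fun w : Om => (Ncnt (s + t) w, Ncnt s w))
            (fun z => (z.1 - z.2)%N)).
  by apply: fiber_measurable_pair; exact: measurable_Ncnt.
rewrite (measure_nat_fibers _ _ mjumps); last first.
  by apply: measurableI => //; exact: measurable_Xt.
have step n : P (B `&` Gam `&` [set w : Om | Xt phi (s + t) w = j]
      `&` [set w | jumps w = n]) =
    (p * (poisson_weight (lam * t) n * (Pm ^+ n) i j))%:E.
  (* Starting from i at time s, the walk is at j at time s + t exactly when the word of its n new
     marks drives i to j. *)
  rewrite (@measure_fin_fibers _ _ _ P {: n.-tuple 'I_M.+1}
    (fun h => run phi i h == j) (fun h => B `&` Gam `&` future_event s t h)) /=; last 3 first.
  - by move=> h; apply: measurableI => //; exact: measurable_future_event.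
  - move=> h h' _ _ [w [[_ [_ hw]] [_ [_ hw']]]]; apply/val_inj.
    by rewrite /= -hw -hw' !size_tuple.
  - apply/seteqP; split=> w.
      move=> [[[[Aw Xi] Gw] Xj] jw]; have sst : s <= s + t by rewrite lerDl.
      have szh : size (marks w (Ncnt s w) n) == n by rewrite size_marks.
      exists (Tuple szh); first by rewrite /= -jw -Xi -Xt_add // Xj.
      split=> //; split=> /=; rewrite size_marks //.
      by rewrite -jw subnKC // Ncnt_homo.
    move=> [h /= /eqP hj [[[Aw Xi] Gw] [Nw hw]]].
    rewrite size_tuple in Nw hw.
    have jw : jumps w = n by rewrite /jumps Nw addKn.
    by do !split=> //=; rewrite Xt_add // Xi -/(jumps w) jw hw.
  under eq_bigr => h _.
    rewrite (determined_future_indep law _ s0 t0 dB) pE size_tuple -EFinM; over.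
  by rewrite sumEFin -!mulr_sumr (run_law qP).
under eq_eseriesr => n _ do rewrite step.
have -> : (fun K => \sum_(0 <= n < K) (p * (poisson_weight (lam * t) n * (Pm ^+ n) i j))%:E)%E =
    EFin \o (fun K => p * \sum_(n < K) poisson_weight (lam * t) n * (Pm ^+ n) i j).
  by apply/funext => K; rewrite sumEFin big_mkord -mulr_sumr.
have pcvg := cvgM (cvg_cst p) (@poisson_series_cvg _ _ Pm t lam i j stP t0 lam0).
rewrite EFin_lim; last by apply/cvg_ex; eexists; exact: pcvg.
by rewrite -EFinM; congr EFin; apply: (cvg_lim (@Rhausdorff R) (pcvg _ _)).
Qed.

Lemma markov_chain_rate_of_law : markov_chain_rate phi (lam *: (Pm - 1)) k P.
Proof.
split.
- by move=> t i t0; exact: Xt_adapted.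
- move=> s t A i j s0 t0 FA; have mG := @measurable_Gamma N M R.
  have mX u l : measurable [set w : Om | Xt phi u w = l] by exact: measurable_Xt.
  (* The determined sets serve as the pi-system; the sigma-algebra they generate contains
     [Filt s]. *)
  rewrite -!setIA; apply: (g_sigma_algebra_scale (G := determined s)).
  + exact: determinedI.
  + exact: determinedT.
  + by move=> B [].
  + apply: measurableI => //; apply: measurableI; exact: mX.
  + by apply: measurableI.
  + by move=> B dB; exact: determined_markov.
  + move: A FA; apply: smallest_sub; first exact: smallest_sigma_algebra.
    by move=> B /determined_filtGen dB; exact: sub_sigma_algebra.
- rewrite -(prob_start law); congr (P _); apply/seteqP.
  by split=> w /=; rewrite XtE Ncnt0.
Qed.

End Markov.

Theorem mainTheorem3 (R : realType) (N : nat) :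
  exists (M : nat) (phi : 'I_N.+1 * 'I_M.+1 -> 'I_N.+1 * 'I_M.+1),
    bijective phi /\
    forall Q : 'M[R]_N.+1, rate_matrix Q ->
      exists (q : 'I_M.+1 -> R) (lam : R),
        [/\ prob_vector q, 0 < lam &
            forall (k : 'I_N.+1) (P : probability (Omega N M R) R),
              law_Pk k q lam P -> markov_chain_rate phi Q k P].

Proof.
(* [M] and [phi] are fixed before [Q] is introduced; uniformizing [Q] then yields [lam] and [Pm],
   and [Pm] yields [q]. *)
have [M [phi [phi_bij hphi]]] := universal_random_map N.
exists M, phi; split=> // Q /rate_matrix_uniformization[Pm [lam [stP lam0 ->]]].
have [q [q_prob qP]] := hphi R Pm stP.
exists q, lam; split=> // k P law.
exact: (markov_chain_rate_of_law law (ltW lam0) stP qP).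
Qed.
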